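(* Let $q$ be an odd prime and $m = \alpha q^k$, where $\alpha, k$ are positive integers with $k \geq 2$ and $q \nmid \alpha$. Let $$G = C_m \rtimes_r C_q = \langle \sigma_1, \sigma_2 : \sigma_1^m = \sigma_2^q = 1,\ \sigma_2^{-1}\sigma_1\sigma_2 = \sigma_1^r \rangle,$$ where $r = \alpha q^{k-1} + 1$. Then $\mathbb{C}(G)$ is rational over $\mathbb{C}$.
   Context: $C_k$ denotes the cyclic group of order $k$. For a finite group $G$ and a field $K$, let $G$ act on the rational function field $K(x_\sigma : \sigma \in G)$ in $|G|$ variables by $K$-automorphisms with $\tau \cdot x_\sigma = x_{\tau\sigma}$ for $\sigma, \tau \in G$, and let $K(G) = K(x_\sigma : \sigma \in G)^G$ be the fixed field; here $K = \mathbb{C}$. A field extension $L$ of $K$ is called rational over $K$ if it is purely transcendental over $K$. *)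

(* Defs.v *)
From HB Require Import structures.
From mathcomp Require Import all_boot all_fingroup all_algebra.
From mathcomp Require Import generic_quotient fraction mpoly complex reals.

Set Implicit Arguments.
Unset Strict Implicit.
Unset Printing Implicit Defensive.

Import GRing.Theory.
Local Open Scope ring_scope.
Local Open Scope quotient_scope.

Section PurelyTranscendental.
Variables (K L : fieldType) (iota : {rmorphism K -> L}).
Implicit Types S F : L -> Prop.

Definition alg_indep S : Prop :=
  forall (n : nat) (y : 'I_n -> L), injective y -> (forall i, S (y i)) ->
  forall p : {mpoly K[n]}, mmap iota y p = 0 -> p = 0.

(* K(S), the least subfield of L containing iota(K) and S
   (0^-1 = 0, so the inverse rule needs no side condition) *)
Inductive adjoin S : L -> Prop :=
| adjoin_base c : adjoin S (iota c)
| adjoin_gen x : S x -> adjoin S x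
| adjoin_sub x y : adjoin S x -> adjoin S y -> adjoin S (x - y)
| adjoin_mul x y : adjoin S x -> adjoin S y -> adjoin S (x * y)
| adjoin_inv x : adjoin S x -> adjoin S x^-1.

(* The intermediate field F is K(S) for some algebraically independent set S,
   which is then a subset of F. *)
Definition purely_transcendental F : Prop :=
  exists S, alg_indep S /\ forall x, F x <-> adjoin S x.

End PurelyTranscendental.

(* Extension to fraction fields of an injective morphism of domains; it does
   not depend on the choice of the representing ratio, see frac_mapE. *)
Definition frac_map (A B : idomainType) (phi : A -> B) (f : {fraction A}) :
    {fraction B} :=
  tofrac (phi \n_(repr f)) / tofrac (phi \d_(repr f)).

Section FracMap.
Variables (A B : idomainType) (phi : {rmorphism A -> B}).
Hypothesis phiI : injective phi.

Lemma frac_reprE (f : {fraction A}) :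
  f = tofrac \n_(repr f) / tofrac \d_(repr f).
Proof.
have d0 : tofrac \d_(repr f) != 0 by rewrite tofrac_eq0 denom_ratioP.
apply: (mulIf d0); rewrite divfK //.
rewrite -{1}[f]reprK; unlock tofrac; rewrite -[LHS]pi_mul.
apply/eqmodP; rewrite /= FracField.equivfE /FracField.mulf.
rewrite !numden_Ratio ?oner_neq0 ?mulr1 ?denom_ratioP //.
by rewrite mulrC.
Qed.

Lemma frac_mapE p q : q != 0 ->
  frac_map phi (tofrac p / tofrac q) = tofrac (phi p) / tofrac (phi q).
Proof.
move=> q0; rewrite /frac_map; set f := tofrac p / tofrac q.
have d0 : \d_(repr f) != 0 := denom_ratioP _.
have phi0 x : x != 0 -> phi x != 0.
  by move=> x0; rewrite -(rmorph0 phi) (inj_eq phiI).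
apply/eqP; rewrite eqr_div ?tofrac_eq0 ?phi0 //.
rewrite -!rmorphM /= tofrac_eq (inj_eq phiI) -tofrac_eq !rmorphM /=.
by rewrite -eqr_div ?tofrac_eq0 // -frac_reprE.
Qed.

Lemma frac_map_tofrac p : frac_map phi (tofrac p) = tofrac (phi p).
Proof.
have := @frac_mapE p 1 (oner_neq0 _).
by rewrite !rmorph1 !divr1.
Qed.

Lemma frac_map_is_zmod_morphism : zmod_morphism (frac_map phi).
Proof.
move=> f g; rewrite (frac_reprE f) (frac_reprE g).
set a := \n_(_); set b := \d_(_); set c := \n_(_); set d := \d_(_).
have b0 : b != 0 := denom_ratioP _; have d0 : d != 0 := denom_ratioP _.
have phi0 x : x != 0 -> phi x != 0.
  by move=> x0; rewrite -(rmorph0 phi) (inj_eq phiI).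
rewrite -mulNr addf_div ?tofrac_eq0 // -!rmorphN -!rmorphM -rmorphD /=.
rewrite !frac_mapE ?mulf_neq0 //.
rewrite -mulNr addf_div ?tofrac_eq0 ?phi0 // -!rmorphN -!rmorphM -rmorphD /=.
by rewrite rmorphD !rmorphM rmorphN.
Qed.

Lemma frac_map_is_monoid_morphism : monoid_morphism (frac_map phi).
Proof.
split; first by have := frac_map_tofrac 1; rewrite !rmorph1.
move=> f g; rewrite (frac_reprE f) (frac_reprE g).
set a := \n_(_); set b := \d_(_); set c := \n_(_); set d := \d_(_).
have b0 : b != 0 := denom_ratioP _; have d0 : d != 0 := denom_ratioP _.
rewrite mulf_div -!rmorphM !frac_mapE ?mulf_neq0 //.
by rewrite mulf_div -!rmorphM.
Qed.

End FracMap.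

Section NoetherField.
Variables (K : fieldType) (gT : finGroupType).
Implicit Types s t : gT.

Local Notation n := #|gT|.

(* K(x_s : s in gT), where x_s is the variable of index enum_rank s *)
Definition ratfun : fieldType := {fraction {mpoly K[n]}}.

Definition ratfun_const : {rmorphism K -> ratfun} := @tofrac _ \o @mpolyC n K.

Definition ratfun_var s : ratfun := tofrac ('X_(enum_rank s) : {mpoly K[n]}).

Definition translate t (p : {mpoly K[n]}) : {mpoly K[n]} :=
  p \mPo [tuple 'X_(enum_rank (t * enum_val i)%g) | i < n].

Definition noether_act t : ratfun -> ratfun := frac_map (translate t).

Definition noether_field (f : ratfun) : Prop := forall t, noether_act t f = f.

Fact translate_is_zmod_morphism t : zmod_morphism (translate t).
Proof. by move=> p q; rewrite /translate rmorphB. Qed.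

Fact translate_is_monoid_morphism t : monoid_morphism (translate t).
Proof. by split=> [|p q]; rewrite /translate ?rmorph1 ?rmorphM. Qed.

HB.instance Definition _ t := GRing.isZmodMorphism.Build
  {mpoly K[n]} {mpoly K[n]} (translate t) (translate_is_zmod_morphism t).
HB.instance Definition _ t := GRing.isMonoidMorphism.Build
  {mpoly K[n]} {mpoly K[n]} (translate t) (translate_is_monoid_morphism t).

Lemma translateC t c : translate t c%:MP = c%:MP.
Proof. exact: comp_mpolyC. Qed.

Lemma translateX t s : translate t 'X_(enum_rank s) = 'X_(enum_rank (t * s)%g).
Proof. by rewrite /translate comp_mpolyXU -tnth_nth tnth_mktuple enum_rankK. Qed.

Lemma translateM t1 t2 p :
  translate (t1 * t2)%g p = translate t1 (translate t2 p).
Proof.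
elim/mpolyind: p => [|c m p _ _ IHp]; first by rewrite !rmorph0.
rewrite !rmorphD /= IHp -mul_mpolyC !rmorphM /= !translateC; congr (_ * _ + _).
rewrite mpolyXE_id !rmorph_prod; apply: eq_bigr => i _.
by rewrite !rmorphXn /= -(enum_valK i) !translateX mulgA.
Qed.

Lemma translate1 p : translate 1%g p = p.
Proof.
elim/mpolyind: p => [|c m p _ _ IHp]; first by rewrite !rmorph0.
rewrite !rmorphD /= IHp -mul_mpolyC !rmorphM /= !translateC; congr (_ * _ + _).
rewrite mpolyXE_id !rmorph_prod; apply: eq_bigr => i _.
by rewrite !rmorphXn /= -(enum_valK i) !translateX mul1g.
Qed.

Lemma translate_inj t : injective (translate t).
Proof.
apply: (can_inj (g := translate t^-1%g)) => p.
by rewrite -translateM mulVg translate1.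
Qed.

HB.instance Definition _ t := GRing.isZmodMorphism.Build ratfun ratfun
  (noether_act t) (frac_map_is_zmod_morphism (@translate_inj t)).
HB.instance Definition _ t := GRing.isMonoidMorphism.Build ratfun ratfun
  (noether_act t) (frac_map_is_monoid_morphism (@translate_inj t)).

Lemma noether_act_const t c : noether_act t (ratfun_const c) = ratfun_const c.
Proof.
rewrite -[ratfun_const c]/(tofrac c%:MP) /noether_act.
by rewrite (frac_map_tofrac (@translate_inj t)) /= translateC.
Qed.

Lemma noether_act_var t s :
  noether_act t (ratfun_var s) = ratfun_var (t * s)%g.
Proof.
by rewrite /noether_act (frac_map_tofrac (@translate_inj t)) /= translateX.
Qed.

End NoetherField.

(* Main.v *)
Require Import Defs.
From HB Require Import structures.
From mathcomp Require Import all_boot all_fingroup all_solvable all_algebra.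
From mathcomp Require Import separable cyclotomic generic_quotient fraction.
From mathcomp Require Import mpoly complex boolp reals ring zify.

Set Implicit Arguments.
Unset Strict Implicit.
Unset Printing Implicit Defensive.

Import GRing.Theory Num.Theory.
Local Open Scope ring_scope.

(** Write [d = alpha * q ^ k.-1], so that [m = d * q], [r = d + 1] and [q]
    divides [d]; let [zeta] be a primitive [m]-th root of unity and
    [omega = zeta ^+ d].

    The fixed field of a finite group of order [n] acting on [n] variables is
    purely transcendental as soon as it is generated by [n] elements
    ([fixed_field_purely_transcendental]): it has transcendence degree [n], and
    a Jacobian argument turns this into algebraic independence of the
    generators.  It remains to find [n = m * q] generators.

    Fourier transforms of the variables along the cosets of [<[s1]>] give
    coordinates [Y a j], with [a] modulo [m] and [j] modulo [q], on which [s1]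
    acts diagonally, by [zeta ^ (a * r ^ j) = (zeta * omega ^ j) ^ a], and [s2]
    by shifting [j].  Put [y j = Y 1 j].  The ratios [z j = y j / y j.+1] all
    have [s1]-eigenvalue [omega^-1] and are permuted cyclically by [s2], so
    their Fourier transforms are eigenvectors of both generators, and the
    quotient [theta] of two of them is fixed by [s1] and multiplied by [omega]
    by [s2].  Similarly, for each [a] the elements [Y a j / y j ^ a] are fixed
    by [s1] and permuted cyclically by [s2].  Dividing all these transforms by
    suitable powers of [theta] yields invariants.  With [theta ^ q] and the
    trace of [y 0 ^ d * z 0], which is invariant because [q] divides [d], they
    form a list of [m * q] invariants.

    That they generate all invariants is Kummer theory.  Let [E0] be the field
    that they generate.  Inverting the Fourier transforms shows that the field
    of rational functions is [E0(theta)(y 0)], where [theta ^ q] is in [E0] and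
    [y 0 ^ m] is in [E0(theta)].  As [s1] fixes [E0(theta)] and multiplies [y 0]
    by [zeta], an element fixed by [s1] is in [E0(theta)]; as [s2] multiplies
    [theta] by [omega], it is in [E0] if it is also fixed by [s2]
    ([kummer_step] twice, in [fixed_in_gen_field]).

    The denominators used above do not vanish because the [y j] are
    independent linear forms, which can be specialized at will
    ([cyclic_sum_neq0]). *)

(** * Generated subfields *)

Section GeneratedSubfield.
Variables (K L : fieldType) (iota : {rmorphism K -> L}).
Implicit Types S : L -> Prop.

(** A boolean predicate, so that it can carry a [divringClosed] structure and
    the closure lemmas [rpredD], [rpredM], [rpred_sum] apply to it. *)
Definition gen_field S : {pred L} := fun x => `[< adjoin iota S x >].

Lemma gen_fieldP S x : reflect (adjoin iota S x) (x \in gen_field S).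
Proof. exact: asboolP. Qed.

Fact gen_field_divring_closed S : divring_closed (gen_field S).
Proof.
split=> [|x y /gen_fieldP Sx /gen_fieldP Sy|x y /gen_fieldP Sx /gen_fieldP Sy].
- by apply/gen_fieldP; rewrite -(rmorph1 iota); apply: adjoin_base.
- exact/gen_fieldP/adjoin_sub.
- by apply/gen_fieldP/adjoin_mul => //; apply: adjoin_inv.
Qed.

HB.instance Definition _ S :=
  GRing.isDivringClosed.Build L (gen_field S) (gen_field_divring_closed S).

Lemma gen_field_const S c : iota c \in gen_field S.
Proof. exact/gen_fieldP/adjoin_base. Qed.

Lemma mem_gen_field S x : S x -> x \in gen_field S.
Proof. by move=> Sx; apply/gen_fieldP/adjoin_gen. Qed.

Lemma gen_field_min S (E : divringClosed L) :
    (forall c, iota c \in E) -> (forall x, S x -> x \in E) ->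
  {subset gen_field S <= E}.
Proof.
move=> EK ES x /gen_fieldP; elim=> {x} [||x y _ ? _ ?|x y _ ? _ ?|x _ ?] //.
- exact: rpredB.
- exact: rpredM.
- by rewrite rpredV.
Qed.

End GeneratedSubfield.

Lemma rmorph_gen_field (K L : fieldType) (iota : {rmorphism K -> L})
    (S : L -> Prop) (phi : {rmorphism L -> L}) :
    (forall c, phi (iota c) = iota c) -> (forall x, S x -> phi x = x) ->
  {in gen_field iota S, forall x, phi x = x}.
Proof.
move=> phiK phiS x /gen_fieldP;
elim=> {x} [//|x /phiS //|x y _ Dx _ Dy|x y _ Dx _ Dy|x _ Dx].
- by rewrite rmorphB Dx Dy.
- by rewrite rmorphM Dx Dy.
- by rewrite fmorphV Dx.
Qed.

(** * Kummer extensions *)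

Section KummerStep.
Variables (L : fieldType) (E : divringClosed L) (phi : {rmorphism L -> L}).
Variables (u eps : L) (n : nat).
Hypotheses (phiE : {in E, forall x, phi x = x}) (epsE : eps \in E).
Hypotheses (eps_prim : n.-primitive_root eps) (n_neq0 : n%:R != 0 :> L).
Hypotheses (phi_u : phi u = eps * u) (unE : u ^+ n \in E).
Implicit Types p : {poly L}.

Let n_gt0 : (0 < n)%N := prim_order_gt0 eps_prim.

Lemma phi_horner p x : p \is a polyOver E -> phi p.[x] = p.[phi x].
Proof.
move=> /polyOverP pE; rewrite !horner_coef rmorph_sum /=; apply: eq_bigr => i _.
by rewrite rmorphM rmorphXn /= phiE.
Qed.

Lemma phi_horner_eps p l : p \is a polyOver E ->
  phi p.[eps ^+ l * u] = p.[eps ^+ l.+1 * u].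
Proof.
move=> pE; rewrite phi_horner // rmorphM rmorphXn /= phi_u phiE //.
by rewrite mulrA -exprSr.
Qed.

Lemma horner_eps_fixed p l : p \is a polyOver E -> phi p.[u] = p.[u] ->
  p.[eps ^+ l * u] = p.[u].
Proof.
move=> pE pu; elim: l => [|l IHl]; first by rewrite expr0 mul1r.
by rewrite -phi_horner_eps // IHl.
Qed.

(** Averaging a fixed value over the powers of [phi] kills every monomial whose
    degree is not a multiple of [n], and [u ^+ n] lies in [E]. *)
Lemma kummer_fixed_horner p :
  p \is a polyOver E -> phi p.[u] = p.[u] -> p.[u] \in E.
Proof.
move=> pE pu.
have -> : p.[u] = n%:R^-1 * \sum_(l < n) p.[eps ^+ l * u].
  rewrite (eq_bigr (fun=> p.[u])) => [|l _]; last exact: horner_eps_fixed.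
  by rewrite sumr_const card_ord -[X in _ * X]mulr_natl mulKf.
apply: rpredM; first by rewrite rpredV rpred_nat.
under eq_bigr do rewrite horner_coef.
rewrite exchange_big /=; apply: rpred_sum => i _.
under eq_bigr do rewrite exprMn mulrA.
rewrite -mulr_suml -mulr_sumr.
have [/dvdnP[c ->] | ni] := boolP (n %| i)%N.
  rewrite mulnC exprM; apply: rpredM; last exact: rpredX.
  apply: rpredM; first exact: (polyOverP pE).
  by apply: rpred_sum => l _; rewrite !rpredX.
suff -> : \sum_(l < n) (eps ^+ l) ^+ i = 0 by rewrite mulr0 mul0r rpred0.
have eps_i : eps ^+ i - 1 != 0.
  by rewrite subr_eq0 -(prim_order_dvd eps_prim).
apply: (mulfI eps_i); rewrite mulr0.
under eq_bigr do rewrite exprAC.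
by rewrite -subrX1 exprAC (prim_expr_order eps_prim) expr1n subrr.
Qed.

(** The ring [E[u]] is a field: the norm of [p.[u]], its product with the other
    conjugates [p.[eps ^+ l * u]], is fixed by [phi] and hence lies in [E]. *)
Lemma kummer_inv_horner p : p \is a polyOver E ->
  exists2 p', p' \is a polyOver E & p.[u]^-1 = p'.[u].
Proof.
move=> pE; pose P l := p \Po (eps ^+ l *: 'X).
have PE l : P l \is a polyOver E.
  by apply: polyOver_comp => //; rewrite polyOverZ ?polyOverX ?rpredX.
have Pu l : (P l).[u] = p.[eps ^+ l * u].
  by rewrite horner_comp hornerZ hornerX.
pose N := \prod_(l < n) P l; pose Q := \prod_(1 <= l < n) P l.
have NE : N \is a polyOver E by apply: rpred_prod.
have QE : Q \is a polyOver E by apply: rpred_prod.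
have Nfix : phi N.[u] = N.[u].
  rewrite !horner_prod rmorph_prod /=.
  under eq_bigr do rewrite Pu phi_horner_eps // -Pu.
  rewrite -(big_mkord predT (fun l => (P l.+1).[u])).
  rewrite -(big_mkord predT (fun l => (P l).[u])).
  case: (n) n_gt0 (prim_expr_order eps_prim) => // n' _ eps_n.
  rewrite big_nat_recr //= [in RHS]big_nat_recl //= mulrC.
  by rewrite !Pu eps_n expr0.
have NQ : N.[u] = p.[u] * Q.[u].
  rewrite /N -(big_mkord predT P) (big_ltn n_gt0) hornerM; congr (_ * _).
  by rewrite Pu expr0 mul1r.
have [pu0|pu0] := eqVneq p.[u] 0.
  by exists 0; rewrite ?rpred0 // pu0 invr0 horner0.
have N0 : N.[u] != 0.
  have Pl0 l : p.[eps ^+ l * u] != 0.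
    elim: l => [|l IHl]; first by rewrite expr0 mul1r.
    by rewrite -phi_horner_eps // fmorph_eq0.
  by rewrite horner_prod prodf_seq_neq0; apply/allP => l _; rewrite Pu Pl0.
exists (N.[u]^-1 *: Q).
  by rewrite polyOverZ // rpredV kummer_fixed_horner.
rewrite hornerZ NQ invfM mulfVK //.
by move: N0; rewrite NQ mulf_eq0 negb_or => /andP[].
Qed.

End KummerStep.

(** The Galois-theoretic half of Kummer theory, without degrees or bases: every
    element of [E(u)] is a polynomial in [u] over [E], to which
    [kummer_fixed_horner] applies. *)
Lemma kummer_step (K L : fieldType) (iota : {rmorphism K -> L})
    (S : L -> Prop) (phi : {rmorphism L -> L}) (u eps : L) (n : nat) :
    {in gen_field iota S, forall x, phi x = x} ->
    eps \in gen_field iota S -> n.-primitive_root eps -> n%:R != 0 :> L ->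
    phi u = eps * u -> u ^+ n \in gen_field iota S ->
  forall x, x \in gen_field iota (fun y => S y \/ y = u) -> phi x = x ->
  x \in gen_field iota S.
Proof.
set E := gen_field iota S => phiE epsE eps_prim n0 phi_u unE x /gen_fieldP Ex.
suff [p pE ->] : exists2 p, p \is a polyOver E & x = p.[u].
  exact: (kummer_fixed_horner phiE epsE eps_prim n0 phi_u unE pE).
elim: Ex => {x} [c|x [Sx|->]|x y _ [p pE ->] _ [p' p'E ->]
                 |x y _ [p pE ->] _ [p' p'E ->]|x _ [p pE ->]].
- by exists (iota c)%:P; rewrite ?hornerC ?polyOverC ?gen_field_const.
- by exists x%:P; rewrite ?hornerC ?polyOverC ?mem_gen_field.
- by exists 'X; rewrite ?hornerX ?polyOverX.
- by exists (p - p'); rewrite ?hornerE ?rpredB.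
- by exists (p * p'); rewrite ?hornerE ?rpredM.
- exact: (kummer_inv_horner phiE epsE eps_prim n0 phi_u unE pE).
Qed.

(** * Derivations of a field over a subfield *)

Lemma mderiv_var (K : fieldType) n (i j : 'I_n) :
  ('X_i : {mpoly K[n]})^`M(j) = (i == j)%:R.
Proof.
rewrite mderivX mnm1E; have [->|_] := eqVneq; last by rewrite scale0r.
by rewrite scale1r -{1}[U_(j)%MM]add0m addmK mpolyX0.
Qed.

Section Derivations.
Variables (K L : fieldType) (iota : {rmorphism K -> L}).

Definition derivation (D : L -> L) : Prop :=
  [/\ {morph D : x y / x - y}, forall x y, D (x * y) = D x * y + x * D y
    & forall c, D (iota c) = 0].

Variable D : L -> L.
Hypothesis derD : derivation D.

Let DB : {morph D : x y / x - y}. Proof. by have [H _ _] := derD; apply: H. Qed.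
Let DM x y : D (x * y) = D x * y + x * D y.
Proof. by have [_ H _] := derD; apply: H. Qed.
Let DC c : D (iota c) = 0. Proof. by have [_ _ H] := derD; apply: H. Qed.
Let D0 : D 0 = 0. Proof. by rewrite -{1}(rmorph0 iota) DC. Qed.
Let D1 : D 1 = 0. Proof. by rewrite -(rmorph1 iota) DC. Qed.
Let DN x : D (- x) = - D x. Proof. by rewrite -sub0r DB D0 sub0r. Qed.
Let DD x y : D (x + y) = D x + D y.
Proof. by rewrite -{1}[y]opprK DB DN opprK. Qed.

Let Dsum I (r : seq I) (P : pred I) (F : I -> L) :
  D (\sum_(i <- r | P i) F i) = \sum_(i <- r | P i) D (F i).
Proof. exact: (big_morph D DD D0). Qed.

Lemma derivX x k : D (x ^+ k) = x ^+ k.-1 *+ k * D x.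
Proof.
elim: k => [|k IHk]; first by rewrite D1 mulr0n mul0r.
rewrite exprS DM IHk mulrA.
have -> : x * (x ^+ k.-1 *+ k) = x ^+ k *+ k.
  by case: k {IHk} => [|k]; rewrite ?mulr0n ?mulr0 // mulrnAr -exprS.
by rewrite mulrSr mulrDl addrC [D x * _]mulrC.
Qed.

Lemma deriv_mmap n (f : 'I_n -> L) (p : {mpoly K[n]}) :
  D (mmap iota f p) = \sum_(i < n) mmap iota f p^`M(i) * D (f i).
Proof.
pose P p := D (mmap iota f p) = \sum_(i < n) mmap iota f p^`M(i) * D (f i).
have PD p1 p2 : P p1 -> P p2 -> P (p1 + p2).
  rewrite /P => H1 H2; rewrite mmapD DD H1 H2 -big_split /=.
  by apply: eq_bigr => i _; rewrite mderivD mmapD mulrDl.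
have PM p1 p2 : P p1 -> P p2 -> P (p1 * p2).
  rewrite /P => H1 H2; rewrite rmorphM /= DM H1 H2 mulr_suml mulr_sumr.
  rewrite -big_split /=; apply: eq_bigr => i _.
  by rewrite mderivM rmorphD !rmorphM /=; ring.
have PC c : P c%:MP.
  by rewrite /P mmapC DC big1 // => i _; rewrite mderivC mmap0 mul0r.
have PX i : P 'X_i.
  rewrite /P mmapX mmap1U (bigD1 i) //= big1 ?addr0 => [|j ji].
    by rewrite mderiv_var eqxx rmorph1 mul1r.
  by rewrite mderiv_var eq_sym (negbTE ji) mmap0 mul0r.
elim/mpolyind: p => [|c m p _ _ IHp]; first by apply: (PC 0).
apply: (PD) => //; rewrite -mul_mpolyC; apply: (PM); first exact: (PC).
rewrite mpolyXE_id; apply: (big_ind P) => [||i _]; first exact: (PC 1).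
  exact: PM.
elim: (m i) => [|k IHk]; first exact: (PC 1).
by rewrite exprS; apply: (PM); first exact: (PX).
Qed.

Lemma deriv_gen_field S x : (forall y, S y -> D y = 0) ->
  x \in gen_field iota S -> D x = 0.
Proof.
move=> DS /gen_fieldP;
elim=> {x} [//|x /DS //|x y _ Dx _ Dy|x y _ Dx _ Dy|x _ Dx].
- by rewrite DB Dx Dy subrr.
- by rewrite DM Dx Dy mul0r mulr0 addr0.
have [->|x0] := eqVneq x 0; first by rewrite invr0.
apply: (mulfI x0); rewrite mulr0; move: D1.
by rewrite -(divff x0) DM Dx mul0r add0r.
Qed.

(** Applying [D] to [p.[x] = 0] gives [p^`().[x] * D x = 0]: a derivation that
    vanishes on a field vanishes on the separable elements over it. *)
Lemma deriv_simple_root (p : {poly L}) x : (forall i, D p`_i = 0) ->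
  p.[x] = 0 -> p^`().[x] != 0 -> D x = 0.
Proof.
move=> Dp px p'x; apply: (mulfI p'x); rewrite mulr0 -D0 -px.
rewrite (horner_coef p) Dsum.
rewrite (@horner_coef_wide _ _ p^`() _ (size_poly _ _)) mulr_suml.
rewrite [in RHS](eq_bigr (fun i : 'I__ => p`_i * (x ^+ i.-1 *+ i * D x)))
  => [|i _]; last by rewrite DM Dp mul0r add0r derivX.
case: (size p) => [|s]; first by rewrite !big_ord0.
rewrite [RHS]big_ord_recl mulr0n mul0r mulr0 add0r /=.
by apply: eq_bigr => i _; rewrite coef_deriv mulrA mulrnAl mulrnAr.
Qed.

End Derivations.

(** With primes denoting derivatives: equal fractions have equal derivatives.
    The hypothesis relating the derivatives is the derivative of
    [a * d = c * b]. *)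
Lemma quotient_rule_unique (F : fieldType) (a b c d a' b' c' d' : F) :
    b != 0 -> d != 0 -> a / b = c / d ->
    a' * d + a * d' = c' * b + c * b' ->
  (c' * d - c * d') / d ^+ 2 = (a' * b - a * b') / b ^+ 2.
Proof.
move=> b0 d0 /eqP; rewrite eqr_div // => /eqP adcb dE.
apply/eqP; rewrite eqr_div ?expf_neq0 // -subr_eq0; apply/eqP.
have -> : (c' * d - c * d') * b ^+ 2 - (a' * b - a * b') * d ^+ 2 =
  - (b * d) * ((a' * d + a * d') - (c' * b + c * b'))
  + (b * d' + d * b') * (a * d - c * b) by ring.
by rewrite adcb dE !subrr !mulr0 addr0.
Qed.

Lemma quotient_ruleB (F : fieldType) (a b c d a' b' c' d' : F) :
    b != 0 -> d != 0 ->
  (((a' * d + a * d') - (c' * b + c * b')) * (b * d)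
     - (a * d - c * b) * (b' * d + b * d')) / (b * d) ^+ 2 =
  (a' * b - a * b') / b ^+ 2 - (c' * d - c * d') / d ^+ 2.
Proof. by move=> b0 d0; field; rewrite ?b0 ?d0. Qed.

Lemma quotient_ruleM (F : fieldType) (a b c d a' b' c' d' : F) :
    b != 0 -> d != 0 ->
  ((a' * c + a * c') * (b * d) - a * c * (b' * d + b * d')) / (b * d) ^+ 2 =
  (a' * b - a * b') / b ^+ 2 * (c / d) + a / b * ((c' * d - c * d') / d ^+ 2).
Proof. by move=> b0 d0; field; rewrite ?b0 ?d0. Qed.

(** * Directional derivatives of rational functions *)

Section DirectionalDerivative.
Variables (K : fieldType) (n : nat).
Local Notation A := {mpoly K[n]}.
Local Notation L := {fraction A}.
Implicit Types (v : 'I_n -> L) (p : A) (f : L).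

Definition dpoly v p : L := \sum_(i < n) v i * tofrac p^`M(i).

Definition dfrac v f : L :=
  (dpoly v \n_(repr f) * tofrac \d_(repr f)
     - tofrac \n_(repr f) * dpoly v \d_(repr f)) / tofrac \d_(repr f) ^+ 2.

Lemma dpolyB v : {morph dpoly v : p p' / p - p'}.
Proof.
move=> p p'; rewrite /dpoly -sumrB; apply: eq_bigr => i _.
by rewrite mderivB rmorphB mulrBr.
Qed.

Lemma dpolyM v p p' :
  dpoly v (p * p') = dpoly v p * tofrac p' + tofrac p * dpoly v p'.
Proof.
rewrite /dpoly mulr_suml mulr_sumr -big_split; apply: eq_bigr => i _ /=.
by rewrite mderivM rmorphD !rmorphM /=; ring.
Qed.

Lemma dpolyC v c : dpoly v c%:MP = 0.
Proof. by rewrite /dpoly big1 // => i _; rewrite mderivC rmorph0 mulr0. Qed.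

(** The quotient rule gives the same value on every representation of a
    fraction, not only on the one selected by [repr]. *)
Lemma dfracE v a b : b != 0 ->
  dfrac v (tofrac a / tofrac b) =
    (dpoly v a * tofrac b - tofrac a * dpoly v b) / tofrac b ^+ 2.
Proof.
move=> b0; rewrite /dfrac; set f := tofrac a / tofrac b.
move: (frac_reprE f) (denom_ratioP (repr f)).
move: \n_(repr f) \d_(repr f) => c d; rewrite {}/f => fE d0.
have tb0 : tofrac b != 0 by rewrite tofrac_eq0.
have td0 : tofrac d != 0 by rewrite tofrac_eq0.
have adcb : a * d = c * b.
  by apply/eqP; rewrite -tofrac_eq !rmorphM /= -(eqr_div _ _ tb0 td0) fE.
have := congr1 (dpoly v) adcb; rewrite !dpolyM => dE.
exact: (quotient_rule_unique tb0 td0 fE dE).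
Qed.

Lemma dfrac_tofrac v p : dfrac v (tofrac p) = dpoly v p.
Proof.
have := @dfracE v p 1 (oner_neq0 _).
by rewrite -mpolyC1 dpolyC mpolyC1 rmorph1 mulr0 subr0 expr1n !divr1 mulr1.
Qed.

Lemma dfrac_derivation v : derivation (@tofrac _ \o @mpolyC n K) (dfrac v).
Proof.
have t0 (b : A) : b != 0 -> tofrac b != 0 by rewrite tofrac_eq0.
split=> [f g|f g|c]; last by rewrite /= dfrac_tofrac dpolyC.
all: rewrite (frac_reprE f) (frac_reprE g).
all: have := denom_ratioP (repr f); have := denom_ratioP (repr g).
all: move: \n_(_) \d_(_) \n_(_) \d_(_) => a b c d d0 b0.
  rewrite -mulNr addf_div ?t0 // -!rmorphN -!rmorphM -rmorphD /=.
  rewrite !dfracE ?mulf_neq0 // mulNr dpolyB !dpolyM !rmorphB !rmorphM /=.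
  exact: quotient_ruleB (t0 _ b0) (t0 _ d0).
rewrite mulf_div -!rmorphM !dfracE ?mulf_neq0 // !dpolyM !rmorphM /=.
exact: quotient_ruleM (t0 _ b0) (t0 _ d0).
Qed.

Lemma dfrac_sum v f :
  dfrac v f = \sum_j v j * dfrac (fun i => (i == j)%:R) f.
Proof.
have E p : dpoly v p = \sum_j v j * dpoly (fun i => (i == j)%:R) p.
  apply: eq_bigr => j _; rewrite /dpoly (bigD1 j) //= eqxx mul1r big1 ?addr0 //.
  by move=> i /negbTE ->; rewrite mul0r.
rewrite /dfrac !E mulr_suml mulr_sumr -sumrB mulr_suml.
by apply: eq_bigr => j _; ring.
Qed.

Lemma dfrac_var v i : dfrac v (tofrac 'X_i) = v i.
Proof.
rewrite dfrac_tofrac /dpoly (bigD1 i) //= big1 ?addr0 => [|j ji].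
  by rewrite mderiv_var eqxx rmorph1 mulr1.
by rewrite mderiv_var eq_sym (negbTE ji) rmorph0 mulr0.
Qed.

End DirectionalDerivative.

(** * A rationality criterion for fixed fields *)

Lemma msize_mderiv (K : fieldType) n (p : {mpoly K[n]}) i N :
  (msize p <= N.+1)%N -> (msize p^`M(i) <= N)%N.
Proof.
move=> pN; rewrite msizeE; apply/bigmax_leqP_seq => m.
rewrite mcoeff_msupp mcoeff_mderiv => pm0 _.
have : (m + U_(i))%MM \in msupp p.
  by rewrite mcoeff_msupp; apply: contraNneq pm0 => ->; rewrite mul0rn.
move=> /msize_mdeg_lt; rewrite mdegD mdeg1 addn1 => mp.
by rewrite -ltnS (leq_trans mp).
Qed.

Lemma mderiv_eq0_const (K : fieldType) n (p : {mpoly K[n]}) :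
    [pchar K] =i pred0 -> (forall i, p^`M(i) = 0) -> p = (p@_0)%:MP.
Proof.
move=> /pcharf0P K0 dp0; apply/mpolyP => m; rewrite mcoeffC.
have [->|m0] := eqVneq m 0%MM; first by rewrite mulr1.
rewrite mulr0; move: m0; rewrite -mdeg_eq0 mdegE sum_nat_eq0 negb_forall.
case/existsP=> i mi; have mE : m = (m - U_(i) + U_(i))%MM.
  by rewrite submK // lep1mP.
have := congr1 (mcoeff (m - U_(i))) (dp0 i).
rewrite mcoeff_mderiv -mE mcoeff0 => /eqP.
by rewrite -mulr_natr mulf_eq0 K0 orbF => /eqP.
Qed.

Lemma prod_XsubC_simple_root (F : fieldType) (T : finType) (x : T -> F) (s : T)
    (P := \prod_(t : T) ('X - (x t)%:P)) :
  injective x -> P.[x s] = 0 /\ P^`().[x s] != 0.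
Proof.
move=> x_inj; rewrite /P (bigD1 s) //= derivM derivXsubC mul1r.
rewrite hornerD !hornerM hornerXsubC subrr !mul0r addr0; split=> //.
rewrite horner_prod prodf_seq_neq0; apply/allP => t _ /=; apply/implyP => ts.
by rewrite hornerXsubC subr_eq0 (inj_eq x_inj) eq_sym.
Qed.

Section RationalityCriterion.
Variables (K : fieldType) (gT : finGroupType).
Hypothesis K_pchar0 : [pchar K] =i pred0.
Local Notation L := (ratfun K gT).
Local Notation iota := (ratfun_const K gT).
Local Notation n := #|gT|.

Lemma ratfun_var_inj : injective (@ratfun_var K gT).
Proof.
move=> s t /eqP; rewrite tofrac_eq => /eqP st; apply: enum_rank_inj.
have := congr1 (mderiv (enum_rank s)) st; rewrite !mderiv_var eqxx.
by case: eqVneq => // _ /eqP; rewrite oner_eq0.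
Qed.

(** Each variable is a simple root of the product of the [X - x_t], whose
    coefficients are symmetric in the [x_t] and therefore invariant. *)
Lemma deriv_fixed_var (D : L -> L) (s : gT) : derivation iota D ->
  (forall f : L, noether_field f -> D f = 0) -> D (ratfun_var K s) = 0.
Proof.
move=> derD Dfix.
pose P : {poly L} := \prod_(t : gT) ('X - (ratfun_var K t)%:P).
have Pfix t : map_poly (@noether_act K gT t) P = P.
  rewrite rmorph_prod [RHS](reindex_inj (mulgI t)) /=; apply: eq_bigr => u _.
  by rewrite rmorphB /= map_polyX map_polyC /= noether_act_var.
have [Ps P's] : P.[ratfun_var K s] = 0 /\ P^`().[ratfun_var K s] != 0.
  exact: prod_XsubC_simple_root ratfun_var_inj.
apply: (deriv_simple_root derD _ Ps P's) => i.
by apply: Dfix => t; rewrite -[in RHS](Pfix t) coef_map.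
Qed.

(** A fixed field generated by as many elements as there are variables is
    purely transcendental, by a Jacobian argument.  A direction killed by the
    Jacobian matrix of the generators defines a derivation vanishing on the
    fixed field, hence on the variables by [deriv_fixed_var], so it is zero and
    the matrix is invertible.  Differentiating an algebraic relation of least
    degree then shows that the partial derivatives of the relation are again
    relations, so they vanish and the relation is constant. *)
Lemma fixed_field_purely_transcendental (e : seq L) : size e = n ->
    (forall f : L,
       noether_field f <-> f \in gen_field iota (fun x => x \in e)) ->
  purely_transcendental iota (@noether_field K gT).
Proof.
move=> size_e fixE; exists (fun x => x \in e).
split=> [|x]; last by rewrite fixE; split=> /gen_fieldP.
pose delta (j i : 'I_n) : L := (i == j)%:R.
pose J : 'M[L]_n := \matrix_(j, k) dfrac (delta j) e`_k.
(* a vector in the left kernel of J is a direction v along which every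
   generator has derivative 0 *)
have J_unit : J \in unitmx.
  rewrite unitmxE unitfE; apply/det0P => -[v /eqP v0 vJ]; apply: v0.
  apply/rowP => j; rewrite !mxE -[LHS](dfrac_var (v 0)) -(enum_valK j).
  apply: deriv_fixed_var; first exact: dfrac_derivation.
  move=> f /fixE; apply: deriv_gen_field; first exact: dfrac_derivation.
  move=> _ /(nthP 0)[k k_lt <-]; rewrite size_e in k_lt.
  move/rowP/(_ (Ordinal k_lt)): vJ; rewrite !mxE => vJk.
  rewrite dfrac_sum -[RHS]vJk; apply: eq_bigr => i _.
  by rewrite [J _ _]mxE.
move=> n' y y_inj ye p.
have [h hE] : exists h : 'I_n' -> 'I_n, forall i, e`_(h i) = y i.
  have ye_ord i : exists k : 'I_n, e`_k = y i.
    by have /(nthP 0)[k] := ye i; rewrite size_e => k_lt; exists (Ordinal k_lt).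
  by have [h hE] := fin_all_exists ye_ord; exists h.
have h_inj : injective h by move=> i i' hii; apply: y_inj; rewrite -!hE hii.
have [N] := ubnP (msize p); elim: N => // N IHN in p *; rewrite ltnS => pN py.
case: N IHN pN => [|N] IHN pN.
  by apply/eqP; rewrite -msize_poly_eq0 -leqn0.
have dp0 i : p^`M(i) = 0.
  apply: IHN; first by rewrite ltnS msize_mderiv.
  (* the relation p involves only some of the generators, selected by h: U
     extends the vector of its partial derivatives by zero *)
  pose U := \col_(k < n) \sum_(i | h i == k) mmap iota y p^`M(i).
  suff /colP/(_ (h i)) : U = 0.
    rewrite !mxE (bigD1 i) //= big1 ?addr0 // => i' /andP[/eqP/h_inj ->].
    by rewrite eqxx.
  rewrite -(mulKmx J_unit U) [X in _ *m X](_ : _ = 0) ?mulmx0 //.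
  apply/colP => j; rewrite !mxE.
  have derj := dfrac_derivation (delta j).
  transitivity (dfrac (delta j) (mmap iota y p)); last first.
    rewrite py; apply: (deriv_gen_field derj (S := fun=> False)) => //.
    exact: rpred0.
  rewrite (deriv_mmap derj) (partition_big h predT) //=; apply: eq_bigr => k _.
  rewrite !mxE mulr_sumr; apply: eq_bigr => i' /eqP <-.
  by rewrite mulrC hE.
have pE := mderiv_eq0_const K_pchar0 dp0.
move: py; rewrite pE mmapC => /eqP.
by rewrite fmorph_eq0 => /eqP ->; rewrite mpolyC0.
Qed.

End RationalityCriterion.

(** * Discrete Fourier transform *)

Lemma prim_root_neq0 (F : fieldType) n (eps : F) :
  n.-primitive_root eps -> eps != 0.
Proof.
move=> eps_prim; apply: contra_eq_neq (prim_expr_order eps_prim) => ->.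
by rewrite expr0n eqn0Ngt (prim_order_gt0 eps_prim) eq_sym oner_neq0.
Qed.

Section DiscreteFourier.
Variables (F : fieldType) (n : nat) (eps : F).
Hypotheses (eps_prim : n.-primitive_root eps) (n_neq0 : n%:R != 0 :> F).
Implicit Types h : nat -> F.

(** A function on the integers modulo [n] is represented by an [n]-periodic
    function on [nat]. *)
Definition dft h j : F := \sum_(i < n) eps^-1 ^+ (i * j) * h i.

Let eps_neq0 : eps != 0.
Proof. exact: prim_root_neq0 eps_prim. Qed.

Lemma dft_inv h i : (i < n)%N ->
  h i = n%:R^-1 * \sum_(j < n) eps ^+ (i * j) * dft h j.
Proof.
move=> i_lt; under eq_bigr do rewrite mulr_sumr.
rewrite exchange_big /= (bigD1 (Ordinal i_lt)) //=.
rewrite [X in _ * (X + _)](eq_bigr (fun=> h i)) => [|j _]; last first.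
  by rewrite mulrA -exprMn divff // expr1n mul1r.
rewrite sumr_const card_ord big1 ?addr0 => [|l li].
  by rewrite -[X in _ * X]mulr_natl mulKf.
have ne1 : eps ^+ i / eps ^+ l - 1 != 0.
  rewrite subr_eq0; apply: contraNneq li => /(congr1 ( *%R^~ (eps ^+ l))).
  rewrite divfK ?expf_neq0 // mul1r => /eqP.
  rewrite (eq_prim_root_expr eps_prim) !modn_small // => /eqP il.
  exact/eqP/val_inj.
under eq_bigr => j _ do rewrite mulrA exprM exprM -exprMn exprVn.
rewrite -mulr_suml; apply/eqP; rewrite mulf_eq0 -(inj_eq (mulfI ne1)) mulr0.
rewrite -subrX1 exprMn exprVn !(exprAC _ _ n) (prim_expr_order eps_prim).
by rewrite !expr1n invr1 mulr1 subrr eqxx.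
Qed.

Lemma dft_succ h j : h n = h 0%N ->
  dft (fun i => h i.+1) j = eps ^+ j * dft h j.
Proof.
move=> hn; rewrite /dft mulr_sumr.
pose f i := eps ^+ j * (eps^-1 ^+ (i * j) * h i).
rewrite -(big_mkord predT f) (eq_bigr (fun i : 'I_n => f i.+1)) => [|i _].
  rewrite -(big_mkord predT (fun i => f i.+1)).
  have epsn := prim_expr_order eps_prim.
  case: n (prim_order_gt0 eps_prim) epsn hn => // n' _ epsn hn.
  rewrite big_nat_recr //= [in RHS]big_nat_recl //= addrC.
  by rewrite /f hn mul0n exprM exprVn epsn invr1 expr1n.
by rewrite /f mulSn exprD !mulrA -exprMn divff // expr1n mul1r.
Qed.

Lemma dft_translate h k j : (forall i, h (i + n)%N = h i) ->
  dft (fun i => h (i + k)%N) j = eps ^+ k ^+ j * dft h j.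
Proof.
move=> h_per; elim: k => [|k IHk].
  by rewrite expr0 expr1n mul1r; apply: eq_bigr => i _; rewrite addn0.
rewrite exprS exprMn -mulrA -IHk -dft_succ; last by rewrite add0n addnC h_per.
by apply: eq_bigr => i _; rewrite addnS.
Qed.

(** The transform diagonalizes a cyclic permutation [phi] of the [h i]. *)
Lemma dft_shift (phi : {rmorphism F -> F}) h j :
    phi eps = eps -> (forall i, phi (h i) = h i.+1) -> h n = h 0%N ->
  phi (dft h j) = eps ^+ j * dft h j.
Proof.
move=> phi_eps phi_h hn; rewrite -dft_succ // rmorph_sum; apply: eq_bigr => i _.
by rewrite rmorphM rmorphXn fmorphV /= phi_eps phi_h.
Qed.

Lemma dft_scale (phi : {rmorphism F -> F}) (c : F) h j :
    phi eps = eps -> (forall i, phi (h i) = c * h i) ->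
  phi (dft h j) = c * dft h j.
Proof.
move=> phi_eps phi_h; rewrite /dft rmorph_sum mulr_sumr; apply: eq_bigr => i _.
by rewrite rmorphM rmorphXn fmorphV /= phi_eps phi_h mulrCA.
Qed.

End DiscreteFourier.

(** * Generators of the fixed field of a metacyclic group *)

Section FixedField.
Variables (K L : fieldType) (iota : {rmorphism K -> L}).
Variables (sg tau : {rmorphism L -> L}) (d q : nat) (zeta : K).
Local Notation m := (d * q)%N.
Hypotheses (q_gt1 : (1 < q)%N) (q_dvd_d : (q %| d)%N).
Hypotheses (zeta_prim : m.-primitive_root zeta) (m_neq0 : m%:R != 0 :> L).
Hypotheses (sgK : forall c, sg (iota c) = iota c).
Hypotheses (tauK : forall c, tau (iota c) = iota c).
Local Notation Z := (iota zeta).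
Definition omega := iota (zeta ^+ d).

(** [Y a j] is the vector of [sg]-weight [a] in the [j]-th translate by [tau];
    the twist [omega ^+ j] reflects the conjugation of [sg] by [tau ^+ j]. *)
Variable Y : nat -> nat -> L.
Hypothesis tauY : forall a j, tau (Y a j) = Y a j.+1.
Hypothesis Yq : forall a, Y a q = Y a 0.
Hypothesis sgY : forall a j, sg (Y a j) = (Z * omega ^+ j) ^+ a * Y a j.
Hypothesis Ygen : forall x, x \in gen_field iota
  (fun x => exists a j, [/\ (a < m)%N, (j < q)%N & x = Y a j]).

(** The vectors of weight 1 span a faithful representation of dimension [q];
    the other constructions are relative to this one. *)
Definition base := Y 1.

(** All ratios have the same [sg]-eigenvalue [omega^-1], so that their
    quotients, and those of their transforms, are [sg]-invariant. *)
Definition ratio j := base j / base j.+1.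
Local Notation rhat := (dft q omega ratio).

(** It is [sg]-invariant and an eigenvector of [tau] for the eigenvalue [omega].
    The transforms of [sg]-invariant elements are eigenvectors of [tau] whose
    eigenvalues are powers of [omega], so dividing them by powers of [theta]
    makes them invariant. *)
Definition theta := rhat 1 / rhat 0.

(** The trace under [tau] of a [sg]-invariant monomial; as its degree in the
    base vectors is [d], it allows to recover their common scale, which the
    degree-0 invariants do not see. *)
Definition degree_invariant := dft q omega (fun i => base i ^+ d * ratio i) 0.

(** For each [a] these elements are [sg]-invariant and permuted cyclically by
    [tau]: dividing by a power of the base vector untwists the weight [a]. *)
Definition weight_ratio a i := Y a i / base i ^+ a.

Hypotheses (base_neq0 : forall j, base j != 0).
Hypotheses (dft0_neq0 : rhat 0 != 0) (dft1_neq0 : rhat 1 != 0).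
Hypothesis deginv_neq0 : degree_invariant != 0.

(** Weight 1 is left out: its weight ratios are all 1. *)
Definition other_weights : seq nat := 0%N :: index_iota 2 m.

(** The first [q] of these generate the invariants of the base vectors, the
    others account for the remaining weights.  Their number [q * m] is the
    order of the group, as required for algebraic independence. *)
Definition fixed_field_gens : seq L :=
  degree_invariant :: theta ^+ q
  :: [seq rhat j / rhat 0 / theta ^+ j | j <- index_iota 2 q]
  ++ [seq dft q omega (weight_ratio a) j / theta ^+ j
        | a <- other_weights, j <- index_iota 0 q].

Let q_gt0 : (0 < q)%N. Proof. exact: ltnW. Qed.
Let m_gt0 : (0 < m)%N. Proof. exact: prim_order_gt0 zeta_prim. Qed.
Let d_gt0 : (0 < d)%N. Proof. by move: m_gt0; rewrite muln_gt0 => /andP[]. Qed.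
Let m_gt1 : (1 < m)%N. Proof. by rewrite (leq_trans q_gt1) // leq_pmull. Qed.

Lemma size_other_weights : size other_weights = (m - 1)%N.
Proof. by rewrite /= size_iota; move: (d * q)%N m_gt1; lia. Qed.

Lemma mem_other_weights a :
  (a < m)%N -> a != 1%N -> a \in other_weights.
Proof. by case: a => [|[|a]] // am _; rewrite inE mem_index_iota am. Qed.

Lemma size_fixed_field_gens : size fixed_field_gens = (q * m)%N.
Proof.
rewrite /fixed_field_gens -cat1s -(cat1s (theta ^+ q)) 3!size_cat size_map.
rewrite size_allpairs size_other_weights !size_iota subn0.
rewrite [X in (X + _)%N]/= [X in (_ + (X + _))%N]/=.
by move: (d * q)%N m_gt1 q_gt1 => M; nia.
Qed.

Let Z_prim : m.-primitive_root Z. Proof. by rewrite fmorph_primitive_root. Qed.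
Let omega_prim : q.-primitive_root omega.
Proof.
rewrite /omega rmorphXn /=.
have := dvdn_prim_root Z_prim (dvdn_mull d (dvdnn q)).
by rewrite mulnK.
Qed.
Let q_neq0 : q%:R != 0 :> L.
Proof. by move: m_neq0; rewrite natrM mulf_eq0 negb_or => /andP[]. Qed.
Let theta_neq0 : theta != 0. Proof. by rewrite mulf_neq0 ?invr_eq0. Qed.
Let sg_omega : sg omega = omega. Proof. exact: sgK. Qed.
Let tau_omega : tau omega = omega. Proof. exact: tauK. Qed.
Let Z_neq0 : Z != 0. Proof. exact: prim_root_neq0 Z_prim. Qed.
Let omega_neq0 : omega != 0. Proof. exact: prim_root_neq0 omega_prim. Qed.

Lemma tau_base i : tau (base i) = base i.+1. Proof. exact: tauY. Qed.

Lemma base_periodic : base q = base 0. Proof. exact: Yq. Qed.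

Lemma tau_ratio i : tau (ratio i) = ratio i.+1.
Proof. by rewrite /ratio fmorph_div !tau_base. Qed.

Lemma ratio_periodic : ratio q = ratio 0.
Proof. by rewrite /ratio -tau_base base_periodic tau_base. Qed.

Lemma sg_base i : sg (base i) = Z * omega ^+ i * base i. Proof. exact: sgY. Qed.

Lemma sg_ratio i : sg (ratio i) = omega^-1 * ratio i.
Proof.
rewrite /ratio fmorph_div !sg_base exprSr; field.
by rewrite base_neq0 Z_neq0 omega_neq0 expf_neq0.
Qed.

Lemma tau_theta : tau theta = omega * theta.
Proof.
rewrite /theta fmorph_div.
rewrite !(dft_shift omega_prim _ tau_omega tau_ratio ratio_periodic).
by rewrite expr0 expr1 mul1r mulrA.
Qed.

Lemma sg_dft_ratio j : sg (rhat j) = omega^-1 * rhat j.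
Proof. exact: dft_scale sg_omega sg_ratio. Qed.

Lemma sg_dft_quot j : sg (rhat j / rhat 0) = rhat j / rhat 0.
Proof.
by rewrite fmorph_div !sg_dft_ratio -mulf_div divff ?mul1r // invr_eq0.
Qed.

Lemma fixed_field_gens_fixed x :
  x \in fixed_field_gens -> sg x = x /\ tau x = x.
Proof.
have omega_theta j : (omega * theta) ^+ j = omega ^+ j * theta ^+ j.
  by rewrite exprMn.
rewrite !inE mem_cat.
move=> /or4P[/eqP->|/eqP->|/mapP[j _ ->]|/allpairsP[[a j] [_ _ ->]]] /=.
- split.
    rewrite -[RHS]mul1r; apply: dft_scale => // i.
    rewrite rmorphM rmorphXn /= sg_base sg_ratio.
    have Zd : Z ^+ d = omega by rewrite /omega rmorphXn.
    have omega_d : omega ^+ d = 1.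
      by apply/eqP; rewrite -(prim_order_dvd omega_prim).
    by rewrite !exprMn Zd (exprAC omega) omega_d expr1n mulr1 mulrACA divff.
  rewrite /degree_invariant (dft_shift omega_prim _ tau_omega).
  + by rewrite expr0 mul1r.
  + by move=> i; rewrite rmorphM rmorphXn /= tau_base tau_ratio.
  + by rewrite base_periodic ratio_periodic.
- split; first by rewrite rmorphXn /= sg_dft_quot.
  rewrite rmorphXn /= tau_theta omega_theta.
  by rewrite (prim_expr_order omega_prim) mul1r.
- split; first by rewrite fmorph_div rmorphXn /= !sg_dft_quot.
  rewrite !fmorph_div rmorphXn /= tau_theta omega_theta.
  rewrite !(dft_shift omega_prim _ tau_omega tau_ratio ratio_periodic).
  rewrite expr0 mul1r -[_ * _ / dft _ _ _ _]mulrA -mulf_div.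
  by rewrite divff ?mul1r ?expf_neq0.
- split.
    rewrite fmorph_div rmorphXn /= sg_dft_quot.
    rewrite (dft_scale (c := 1) _ _ sg_omega) ?mul1r // => i.
    rewrite mul1r /weight_ratio fmorph_div rmorphXn /= sgY sg_base.
    rewrite (exprMn _ _ (base i)) -mulf_div divff ?mul1r //.
    by rewrite expf_neq0 // mulf_neq0 // expf_neq0.
  rewrite fmorph_div rmorphXn /= tau_theta omega_theta.
  rewrite (dft_shift omega_prim _ tau_omega) => [|i|].
  + by rewrite -mulf_div divff ?mul1r ?expf_neq0.
  + by rewrite fmorph_div rmorphXn /= tauY tau_base.
  + by rewrite /weight_ratio Yq base_periodic.
Qed.

Lemma base_prod i : base i = base 0 / \prod_(l < i) ratio l.
Proof.
elim: i => [|i IHi]; first by rewrite big_ord0 divr1.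
by rewrite big_ord_recr /= invfM mulrA -IHi /ratio invf_div mulrC divfK.
Qed.

(** Adjoining [theta] and then [base 0] to the field [E0] yields everything,
    through two Kummer extensions, of degrees [q] and [m] and with Galois groups
    generated by [tau] and [sg]. *)
Let E0 := gen_field iota (fun x => x \in fixed_field_gens).
Let E1 := gen_field iota (fun x => x \in fixed_field_gens \/ x = theta).
Let E2 := gen_field iota
  (fun x => (x \in fixed_field_gens \/ x = theta) \/ x = base 0).

Lemma E1_gens x : x \in fixed_field_gens -> x \in E1.
Proof. by move=> xg; apply: mem_gen_field; left. Qed.

Lemma E1_theta : theta \in E1. Proof. by apply: mem_gen_field; right. Qed.

Lemma E12 : {subset E1 <= E2}.
Proof.
apply: gen_field_min => [c|x Hx]; first exact: gen_field_const.
by apply: mem_gen_field; left.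
Qed.

Lemma E2_base0 : base 0 \in E2. Proof. by apply: mem_gen_field; right. Qed.

Lemma E1_dft_ratio j : (j < q)%N -> rhat j / rhat 0 \in E1.
Proof.
case: j => [|[|j]] jq; first by rewrite divff // rpred1.
  exact: E1_theta.
rewrite -[_ / _](divfK (x := theta ^+ j.+2)) ?expf_neq0 //.
apply: rpredM; last by rewrite rpredX ?E1_theta.
apply: E1_gens; rewrite !inE mem_cat; apply/or4P; constructor 3.
by apply/mapP; exists j.+2; rewrite // mem_index_iota jq.
Qed.

Lemma E1_const c : iota c \in E1. Proof. exact: gen_field_const. Qed.

Lemma E1_norm_ratio i : (i < q)%N -> ratio i / rhat 0 \in E1.
Proof.
move=> iq; rewrite (dft_inv omega_prim q_neq0 ratio iq) -mulrA mulr_suml.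
apply: rpredM; first by rewrite rpredV rpred_nat.
apply: rpred_sum => j _; rewrite -mulrA; apply: rpredM.
  by rewrite rpredX ?E1_const.
exact: E1_dft_ratio.
Qed.

Lemma ratio_neq0 i : ratio i != 0. Proof. by rewrite mulf_neq0 ?invr_eq0. Qed.

Let rel_ratio i := ratio i / ratio 0.

Lemma E1_rel_ratio i : (i < q)%N -> rel_ratio i \in E1.
Proof.
move=> iq; have -> : rel_ratio i = ratio i / rhat 0 / (ratio 0 / rhat 0).
  by rewrite invf_div mulrA divfK.
by rewrite rpred_div ?E1_norm_ratio.
Qed.

Lemma ratioE i : ratio i = ratio 0 * rel_ratio i.
Proof. by rewrite mulrC divfK ?ratio_neq0. Qed.

(** The product of all the ratios telescopes to 1. *)
Lemma E1_ratio0q : ratio 0 ^+ q \in E1.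
Proof.
have := base_prod q; rewrite base_periodic => base0E.
have : \prod_(l < q) ratio l = 1.
  apply: (mulIf (base_neq0 0)); rewrite mul1r {1}base0E mulrCA divff ?mulr1 //.
  by apply/prodf_neq0 => i _; rewrite ratio_neq0.
under eq_bigr do rewrite ratioE.
rewrite big_split prodr_const card_ord /= => prodE.
have prod_rel_neq0 : \prod_(l < q) rel_ratio l != 0.
  by apply/prodf_neq0 => i _; rewrite mulf_neq0 ?invr_eq0 ?ratio_neq0.
rewrite -[_ ^+ q](mulfK prod_rel_neq0) prodE div1r.
by rewrite rpredV; apply: rpred_prod => i _; apply: E1_rel_ratio.
Qed.

(** Since [q] divides [d], the [d]-th powers of the ratios are in [E1] by
    [E1_ratio0q]. *)
Lemma E1_degree_invariant :
  exists2 e, e \in E1 & degree_invariant = base 0 ^+ d * ratio 0 * e.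
Proof.
exists (\sum_(i < q) (\prod_(l < i) ratio l ^+ d)^-1 * rel_ratio i).
  apply: rpred_sum => i _; apply: rpredM; last exact: E1_rel_ratio.
  rewrite rpredV; apply: rpred_prod => l _; case/dvdnP: q_dvd_d => d' ->.
  rewrite mulnC exprM rpredX // ratioE exprMn.
  rewrite rpredM ?E1_ratio0q ?rpredX ?E1_rel_ratio //.
  exact: ltn_trans (ltn_ord i).
rewrite mulr_sumr; apply: eq_bigr => i _; rewrite muln0 expr0 mul1r.
rewrite base_prod expr_div_n prodrXl ratioE; ring.
Qed.

Lemma E2_ratio0 : ratio 0 \in E2 /\ base 0 ^+ m \in E1.
Proof.
have [e eE deginvE] := E1_degree_invariant; have e0 : e != 0.
  by apply: contraNneq deginv_neq0 => e0; rewrite deginvE e0 mulr0.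
have deginvE1 : degree_invariant \in E1 by apply: E1_gens; rewrite inE eqxx.
have base0d : base 0 ^+ d = degree_invariant / e / ratio 0.
  by rewrite deginvE !mulfK ?ratio_neq0.
split.
  have -> : ratio 0 = degree_invariant / e / base 0 ^+ d.
    by rewrite deginvE mulfK // mulrC mulKf ?expf_neq0.
  by rewrite !rpred_div ?rpredX ?E2_base0 ?E12.
by rewrite exprM base0d expr_div_n rpred_div ?E1_ratio0q // rpredX // rpred_div.
Qed.

Lemma E2_ratio i : (i < q)%N -> ratio i \in E2.
Proof.
by move=> iq; rewrite ratioE rpredM ?(E2_ratio0.1) // E12 // E1_rel_ratio.
Qed.

Lemma E2_base i : (i < q)%N -> base i \in E2.
Proof.
move=> iq; rewrite base_prod rpred_div ?E2_base0 //; apply: rpred_prod => l _.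
by rewrite E2_ratio // (ltn_trans (ltn_ord l)).
Qed.

Lemma E1_weight_ratio a i : (a < m)%N -> (i < q)%N -> weight_ratio a i \in E1.
Proof.
move=> am iq; have [->|a1] := eqVneq a 1%N.
  by rewrite /weight_ratio expr1 divff // rpred1.
rewrite (dft_inv omega_prim q_neq0 (weight_ratio a) iq).
rewrite rpredM ?rpredV ?rpred_nat //.
apply: rpred_sum => j _; rewrite rpredM ?rpredX ?E1_const //.
rewrite -[dft _ _ _ _](divfK (x := theta ^+ j)) ?expf_neq0 //.
rewrite rpredM ?rpredX ?E1_theta //; apply: E1_gens.
rewrite !inE mem_cat; apply/or4P; constructor 4.
apply/allpairsP; exists (a, nat_of_ord j); split=> //=.
  exact: mem_other_weights.
by rewrite mem_index_iota ltn_ord.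
Qed.

Lemma E2_full x : x \in E2.
Proof.
apply: (gen_field_min (E := E2)) (Ygen x) => [b|_ [a [i [am iq ->]]]].
  exact: gen_field_const.
have -> : Y a i = weight_ratio a i * base i ^+ a by rewrite divfK ?expf_neq0.
by rewrite rpredM ?rpredX ?E2_base // E12 // E1_weight_ratio.
Qed.

Lemma fixed_in_gen_field x : sg x = x -> tau x = x ->
  x \in gen_field iota (fun x => x \in fixed_field_gens).
Proof.
move=> sgx taux.
have E0_theta : theta ^+ q \in E0.
  by apply: mem_gen_field; rewrite !inE eqxx orbT.
have tauE0 : {in E0, forall x, tau x = x}.
  by apply: rmorph_gen_field => // y /fixed_field_gens_fixed[].
have sgE1 : {in E1, forall x, sg x = x}.
  apply: rmorph_gen_field => // y [/fixed_field_gens_fixed[]|->] //.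
  exact: sg_dft_quot.
apply: (kummer_step tauE0 _ omega_prim q_neq0 tau_theta E0_theta) => //.
  exact: gen_field_const.
apply: (kummer_step sgE1 _ Z_prim m_neq0 _ E2_ratio0.2) => //.
- exact: gen_field_const.
- by rewrite sg_base expr0 mulr1.
- exact: E2_full.
Qed.

Theorem fixed_fieldP x : (sg x = x /\ tau x = x) <->
  x \in gen_field iota (fun x => x \in fixed_field_gens).
Proof.
split=> [[]|xE]; first exact: fixed_in_gen_field.
by split; apply: (rmorph_gen_field _ _ xE) => // y /fixed_field_gens_fixed[].
Qed.

End FixedField.

(** * Existence of primitive roots of unity *)

Lemma prim_root_exists (F : closedFieldType) n : n%:R != 0 :> F ->
  exists z : F, n.-primitive_root z.
Proof.
move=> n0; have n_gt0 : (0 < n)%N by case: n n0; rewrite ?eqxx.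
pose p : {poly F} := 'X^n - 1; have [r Dp] := closed_field_poly_normal p.
rewrite (monicP _) ?monicXnsubC // scale1r in Dp.
have rn1 : all n.-unity_root r by apply/allP=> z; rewrite -root_prod_XsubC -Dp.
have sz_r : (n < (size r).+1)%N.
  by rewrite -(size_prod_XsubC r id) -Dp size_XnsubC.
have [|z _ ?] := hasP (has_prim_root n_gt0 rn1 _ sz_r); last by exists z.
by rewrite -separable_prod_XsubC -Dp separable_Xn_sub_1.
Qed.

(** * Split metacyclic groups given by a presentation *)

Section SplitMetacyclic.
Variables (m q r : nat) (gT : finGroupType).
Hypotheses (m_gt1 : (1 < m)%N) (q_gt1 : (1 < q)%N) (rq1 : r ^ q = 1 %[mod m]).
Hypothesis gTP : ([set: gT] \isog
  Grp (s1 : s2 : s1 ^+ m = s2 ^+ q = 1, s2^-1 * s1 * s2 = s1 ^+ r))%g.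

Lemma isoGrp_conj : ([set: gT] \isog
  Grp (x : y : x ^+ m, y ^+ q, x ^ y = x ^+ r))%g.
Proof.
move=> rT H; rewrite gTP; apply: eq_existsb => -[x y] /=.
by rewrite !xpair_eqE /= conjgE mulgA.
Qed.

(** The presentation alone only bounds the order from above; the semidirect
    product [Extremal.gtype] satisfies it and has the expected order. *)
Lemma split_metacyclic_card : #|gT| = (q * m)%N.
Proof.
rewrite -cardsT -(Extremal.card r q_gt1 m_gt1).
set H := [set: Extremal.gtype m q r].
have isoH : (H \isog Grp (x : y : x ^+ m, y ^+ q, x ^ y = x ^+ r))%g.
  apply: Extremal.Grp => //.
  have r_unit : (r%:R : 'Z_#[Zp1 : 'Z_m]%g) \is a GRing.unit.
    rewrite unitZpE ?order_Zp1 ?Zp_cast //.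
    have q_gt0 := ltnW q_gt1.
    rewrite -(coprime_pexpr _ _ q_gt0) -coprime_modr rq1 coprime_modr.
    exact: coprimen1.
  exists (Zp_unitm (FinRing.unit _ r_unit)).
  rewrite Aut_aut order_injm ?injm_Zp_unitm ?in_setT //; split=> //.
    rewrite order_dvdn -val_eqE /= FinRing.val_unitX /= -natrX -Zp_nat_mod.
      by rewrite order_Zp1 Zp_cast // rq1 modn_small.
    by rewrite order_Zp1 Zp_cast.
  apply/eqP; rewrite autE ?cycle_id // eq_expg_mod_order /= val_Zp_nat.
    by rewrite order_Zp1 Zp_cast // modn_mod.
  by rewrite order_Zp1 Zp_cast.
have oneway (aT bT : finGroupType) :
    ([set: aT] \isog Grp (x : y : x ^+ m, y ^+ q, x ^ y = x ^+ r))%g ->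
    ([set: bT] \isog Grp (x : y : x ^+ m, y ^+ q, x ^ y = x ^+ r))%g ->
  (#|[set: aT]| %| #|[set: bT]|)%N.
  by move=> Ha Hb; apply: card_homg; rewrite Hb; apply: isoGrp_hom.
by apply/eqP; rewrite eqn_dvd; apply/andP; split; apply: oneway => //;
  apply: isoGrp_conj.
Qed.

Lemma split_metacyclic_generators : exists s1 s2 : gT,
  [/\ (s1 ^+ m = 1)%g, (s2 ^+ q = 1)%g, (s1 ^ s2 = s1 ^+ r)%g
    & forall g, exists j i,
        [/\ (j < q)%N, (i < m)%N & g = (s2 ^+ j * s1 ^+ i)%g]].
Proof.
have /existsP[[s1 s2] /= /eqP[genE s1m s2q s12]] := isoGrp_hom isoGrp_conj.
exists s1, s2; split=> // g.
have s2N : <[s2]>%g \subset 'N(<[s1]>)%g by rewrite norms_cycle s12 mem_cycle.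
have : g \in (<[s2]> * <[s1]>)%g.
  by rewrite -(norm_joinEl s2N) joingC genE in_setT.
case/mulsgP=> _ _ /cycleP[j ->] /cycleP[i ->] ->.
exists (j %% q)%N, (i %% m)%N; rewrite !ltn_mod (ltnW q_gt1) (ltnW m_gt1).
by split=> //; rewrite !expg_mod.
Qed.

End SplitMetacyclic.

(** * The action on rational functions *)

Lemma ratfun_gen_field (K : fieldType) (gT : finGroupType)
    (S : ratfun K gT -> Prop) :
    (forall g, ratfun_var K g \in gen_field (ratfun_const K gT) S) ->
  forall f, f \in gen_field (ratfun_const K gT) S.
Proof.
move=> varS f; rewrite (frac_reprE f).
suff polyS p : tofrac p \in gen_field (ratfun_const K gT) S.
  by apply: rpred_div; apply: polyS.
elim/mpolyind: p => [|c m p _ _ IHp]; first by rewrite rmorph0 rpred0.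
rewrite rmorphD /= rpredD // -mul_mpolyC rmorphM rpredM //.
  exact: (gen_field_const (ratfun_const K gT)).
rewrite mpolyXE_id rmorph_prod rpred_prod // => i _.
by rewrite rmorphXn rpredX //= -(enum_valK i); apply: varS.
Qed.

Lemma noether_act_frac (K : fieldType) (gT : finGroupType) (t : gT)
    (a b : {mpoly K[#|gT|]}) : b != 0 ->
  noether_act t (tofrac a / tofrac b) =
    tofrac (translate t a) / tofrac (translate t b) :> ratfun K gT.
Proof. by move=> b0; apply: (frac_mapE (@translate_inj K gT t)). Qed.

Lemma noether_actM (K : fieldType) (gT : finGroupType) (s t : gT)
    (f : ratfun K gT) :
  noether_act (s * t)%g f = noether_act s (noether_act t f).
Proof.
have := denom_ratioP (repr f); have := frac_reprE f.
move: \n_(repr f) \d_(repr f) => a b -> b0.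
have tb0 : translate t b != 0.
  by rewrite -(rmorph0 (@translate K gT t)) (inj_eq (@translate_inj _ _ _)).
rewrite (noether_act_frac (s * t) a b0) (noether_act_frac t a b0).
by rewrite (noether_act_frac s _ tb0) !translateM.
Qed.

Lemma noether_act1 (K : fieldType) (gT : finGroupType) (f : ratfun K gT) :
  noether_act 1%g f = f.
Proof.
have := denom_ratioP (repr f); have := frac_reprE f.
move: \n_(repr f) \d_(repr f) => a b -> b0.
by rewrite (noether_act_frac 1 a b0) !translate1.
Qed.

Lemma noether_actX (K : fieldType) (gT : finGroupType) (s : gT) k
    (f : ratfun K gT) :
  noether_act s f = f -> noether_act (s ^+ k)%g f = f.
Proof.
move=> sf; elim: k => [|k IHk]; first exact: noether_act1.
by rewrite expgS noether_actM IHk.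
Qed.

(** Clearing the denominators and specializing with [ev], which kills [l 1]
    only, leaves the single term [i = 0], where [l 1] was the denominator. *)
Lemma cyclic_sum_neq0 (K : fieldType) (A : idomainType)
    (ev : {rmorphism A -> K}) (q : nat) (l cc : nat -> A) e : (1 < q)%N ->
    l q = l 0%N -> (forall i, l i != 0) ->
    ev (l 1%N) = 0 -> (forall i, (i < q)%N -> i != 1%N -> ev (l i) != 0) ->
    ev (cc 0%N) != 0 ->
  \sum_(i < q) tofrac (cc i) *
      (tofrac (l i) ^+ e * (tofrac (l i) / tofrac (l i.+1)))
    != 0 :> {fraction A}.
Proof.
case: q => [|q] // q_gt0 lq l_neq0 ev1 ev_neq0 evc.
pose N := \prod_(j < q.+1) l j; pose N' i := \prod_(j < q.+1 | j != ordS i) l j.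
have lS (i : 'I_q.+1) : l i.+1 = l (ordS i).
  rewrite /=; have := ltn_ord i; rewrite leq_eqVlt => /orP[/eqP->|iq].
    by rewrite modnn.
  by rewrite modn_small.
have NE i : tofrac N / tofrac (l (ordS i)) = tofrac (N' i).
  by rewrite /N (bigD1 (ordS i)) //= rmorphM /= mulrC mulKf ?tofrac_eq0.
pose P := \sum_(i < q.+1) cc i * (l i ^+ e * (l i * N' i)).
have evP : ev P != 0.
  rewrite rmorph_sum (bigD1 ord0) //= big1 ?addr0 => [|i i0].
    rewrite !rmorphM rmorphXn !mulf_neq0 ?expf_neq0 ?ev_neq0 //.
    rewrite rmorph_prod; apply/prodf_neq0 => j j1; apply: ev_neq0 => //.
    by move: j1; rewrite -val_eqE /= modn_small.
  rewrite !rmorphM rmorph_prod (bigD1 (Ordinal q_gt0)) /= ?ev1 ?mul0r ?mulr0 //.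
  rewrite -val_eqE /=; have := ltn_ord i; rewrite leq_eqVlt => /orP[/eqP->|iq].
    by rewrite modnn.
  by rewrite modn_small // eqSS eq_sym.
apply: contra_neq evP => sum0; suff -> : P = 0 by rewrite rmorph0.
apply/eqP; rewrite -tofrac_eq0 rmorph_sum; apply/eqP.
rewrite -[RHS](mulr0 (tofrac N)) -[in RHS]sum0 mulr_sumr.
apply: eq_bigr => i _; rewrite lS !rmorphM rmorphXn /= -NE.
by rewrite !(mulrCA (tofrac N)).
Qed.

(** * The fixed field of the regular representation *)

Section Metacyclic.
Variables (K : closedFieldType) (gT : finGroupType) (d q : nat).
Hypothesis K_pchar0 : [pchar K] =i pred0.
Hypotheses (q_gt1 : (1 < q)%N) (d_gt0 : (0 < d)%N) (q_dvd_d : (q %| d)%N).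
Local Notation m := (d * q)%N.
Hypothesis gTP : ([set: gT] \isog
  Grp (s1 : s2 : s1 ^+ m = s2 ^+ q = 1, s2^-1 * s1 * s2 = s1 ^+ d.+1))%g.
Local Notation L := (ratfun K gT).
Local Notation iota := (ratfun_const K gT).
Local Notation X := (@ratfun_var K gT).

(** The Fourier transforms of the variables along the cosets of [<[s1]>] are the
    weight vectors to which [fixed_fieldP] applies. *)
Theorem metacyclic_purely_transcendental :
  purely_transcendental iota (@noether_field K gT).
Proof.
have nat_neq0 n : (0 < n)%N -> n%:R != 0 :> K.
  by move/pcharf0P: K_pchar0 => ->; case: n.
have natL_neq0 n : (0 < n)%N -> n%:R != 0 :> L.
  by move=> n0; rewrite -(rmorph_nat iota) fmorph_eq0 nat_neq0.
have m_gt1 : (1 < m)%N by rewrite (leq_trans q_gt1) // leq_pmull.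
have m_gt0 := ltnW m_gt1; have q_gt0 := ltnW q_gt1.
have [zeta zeta_prim] := prim_root_exists (nat_neq0 m m_gt0).
have om_d : (zeta ^+ d) ^+ d = 1.
  have /dvdnP[d' dE] := q_dvd_d.
  by rewrite {2}dE mulnC exprM -(exprM zeta) (prim_expr_order zeta_prim) expr1n.
have zeta_r j : zeta ^+ (d.+1 ^ j) = zeta * (zeta ^+ d) ^+ j.
  elim: j => [|j IHj]; first by rewrite expn0 expr0 mulr1.
  rewrite expnSr exprM IHj exprS exprMn (exprAC _ j d) om_d expr1n mulr1.
  by rewrite -mulrA -exprSr.
have rq1 : d.+1 ^ q = 1 %[mod m].
  apply/eqP; rewrite -(eq_prim_root_expr zeta_prim) zeta_r -exprM.
  by rewrite (prim_expr_order zeta_prim) mulr1 expr1.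
have card_gT := split_metacyclic_card m_gt1 q_gt1 rq1 gTP.
have [s1 [s2 [s1m s2q s12 gen]]] := split_metacyclic_generators m_gt1 q_gt1 gTP.
pose Z := iota zeta.
have Z_prim : m.-primitive_root Z by rewrite fmorph_primitive_root.
pose x j i : L := X (s2 ^+ j * s1 ^+ i)%g.
pose Y a j := dft m Z (x j) a.
have s1_s2 j : (s1 * s2 ^+ j = s2 ^+ j * s1 ^+ (d.+1 ^ j))%g.
  rewrite conjgC; congr (_ * _)%g; elim: j => [|j IHj]; first by rewrite conjg1.
  by rewrite expgSr conjgM IHj conjXg s12 -expgM expnSr mulnC.
have tauY a j : noether_act s2 (Y a j) = Y a j.+1.
  rewrite rmorph_sum; apply: eq_bigr => i _.
  rewrite rmorphM rmorphXn fmorphV /= noether_act_const noether_act_var.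
  by rewrite mulgA -expgS.
have Yq a : Y a q = Y a 0%N.
  by apply: eq_bigr => i _; rewrite /x s2q expg0.
have sgY a j :
    noether_act s1 (Y a j) = (Z * omega iota d zeta ^+ j) ^+ a * Y a j.
  rewrite -[Z * _](_ : Z ^+ (d.+1 ^ j) = _); last first.
    by rewrite /Z /omega -!rmorphXn -rmorphM zeta_r.
  rewrite -dft_translate //; last by move=> i; rewrite /x expgD s1m mulg1.
  rewrite rmorph_sum; apply: eq_bigr => i _.
  rewrite rmorphM rmorphXn fmorphV /= noether_act_const noether_act_var.
  by rewrite mulgA s1_s2 -mulgA -expgD addnC.
(* counting makes the normal form of the elements unique *)
pose f (ij : 'I_q * 'I_m) : gT := (s2 ^+ ij.1 * s1 ^+ ij.2)%g.
have f_inj : injective f.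
  have /image_injP f_inj : #|image f {: 'I_q * 'I_m}| == #|{: 'I_q * 'I_m}|.
    rewrite card_prod !card_ord -card_gT; apply/eqP/eq_card => g.
    have [j [i [jq im ->]]] := gen g.
    by apply/imageP; exists (Ordinal jq, Ordinal im).
  by move=> u v; apply: f_inj.
pose ell j : {mpoly K[#|gT|]} :=
  \sum_(i < m) ((zeta^-1) ^+ i)%:MP * 'X_(enum_rank (s2 ^+ j * s1 ^+ i)%g).
have yE j : Y 1%N j = tofrac (ell j).
  rewrite rmorph_sum; apply: eq_bigr => i _.
  by rewrite rmorphM muln1 /Z -fmorphV -rmorphXn.
have ell_q : ell q = ell 0%N.
  by apply: eq_bigr => i _; rewrite s2q expg0.
(* the values of the linear forms ell j at a point can be prescribed, by
   inverse Fourier transform *)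
have ev_ell (b : nat -> K) : exists ev : {rmorphism {mpoly K[#|gT|]} -> K},
    (forall c, ev c%:MP = c) /\ forall j, (j < q)%N -> ev (ell j) = m%:R * b j.
  pose v (k : 'I_#|gT|) : K :=
    \sum_(ij | f ij == enum_val k) zeta ^+ ij.2 * b ij.1.
  exists (meval v); split=> [c|j jq]; first exact: mevalC.
  rewrite rmorph_sum /= (eq_bigr (fun=> b j)) => [|i _].
    by rewrite sumr_const card_ord mulr_natl.
  rewrite mevalM mevalC mevalXU /v enum_rankK.
  rewrite (big_pred1 (Ordinal jq, i)) => [|ij]; last first.
    by rewrite -[(s2 ^+ j * _)%g]/(f (Ordinal jq, i)) (inj_eq f_inj).
  by rewrite mulrA -exprMn mulVf ?expr1n ?mul1r ?(prim_root_neq0 zeta_prim).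
have ell_neq0 j : ell j != 0.
  rewrite -tofrac_eq0 -yE; elim: j => [|j IHj].
    rewrite yE tofrac_eq0; have [ev [_ evE]] := ev_ell (fun=> 1).
    apply: contraTneq (nat_neq0 m m_gt0) => e0.
    by rewrite -[m%:R]mulr1 -(evE 0%N) // e0 rmorph0 eqxx.
  by rewrite -tauY fmorph_eq0.
have y_neq0 j : Y 1%N j != 0 by rewrite yE tofrac_eq0.
have sum_neq0 (e j : nat) :
    dft q (omega iota d zeta)
      (fun i => Y 1%N i ^+ e * (Y 1%N i / Y 1%N i.+1)) j != 0.
  have [ev [evC evE]] := ev_ell (fun i => (i != 1%N)%:R).
  pose cc i : {mpoly K[#|gT|]} := ((zeta ^+ d)^-1 ^+ (i * j))%:MP.
  rewrite [dft _ _ _ _](_ : _ = \sum_(i < q) tofrac (cc i) *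
     (tofrac (ell i) ^+ e * (tofrac (ell i) / tofrac (ell i.+1)))).
    apply: (@cyclic_sum_neq0 _ _ ev) => // [|i iq i1|].
    - by rewrite evE // mulr0.
    - by rewrite evE // i1 mulr1 nat_neq0.
    - by rewrite evC mul0n expr0 oner_neq0.
  apply: eq_bigr => i _; rewrite !yE; congr (_ * _).
  by rewrite /omega -fmorphV -rmorphXn.
pose e := fixed_field_gens iota d q zeta Y.
have z0_neq0 j : dft q (omega iota d zeta) (ratio Y) j != 0.
  have := sum_neq0 0%N j; congr (_ != 0).
  by apply: eq_bigr => i _; rewrite expr0 mul1r.
have p_neq0 := sum_neq0 d 0%N.
have sgK c : noether_act s1 (iota c) = iota c := noether_act_const s1 c.
have tauK c : noether_act s2 (iota c) = iota c := noether_act_const s2 c.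
have Ygen g : g \in gen_field iota
    (fun y => exists a j, [/\ (a < m)%N, (j < q)%N & y = Y a j]).
  apply: ratfun_gen_field => {}g; have [j [i [jq im ->]]] := gen g.
  rewrite -[X _]/(x j i) (dft_inv Z_prim (natL_neq0 m m_gt0) _ im).
  rewrite rpredM ?rpredV ?rpred_nat //; apply: rpred_sum => a _.
  rewrite rpredM ?rpredX //; first exact: gen_field_const.
  by apply: mem_gen_field; exists a, j.
have fixP g := fixed_fieldP q_gt1 q_dvd_d zeta_prim (natL_neq0 m m_gt0) sgK tauK
  tauY Yq sgY Ygen y_neq0 (z0_neq0 0%N) (z0_neq0 1%N) p_neq0 g.
apply: (fixed_field_purely_transcendental K_pchar0 (e := e)).
  rewrite card_gT; exact: (size_fixed_field_gens q_gt1 q_dvd_d zeta_prim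
    (natL_neq0 m m_gt0) (z0_neq0 0%N) (z0_neq0 1%N) p_neq0).
move=> g; split=> [gfix | /fixP[g1 g2] t].
  by apply/fixP; split; apply: gfix.
have [j [i [_ _ ->]]] := gen t.
by rewrite noether_actM (noether_actX i g1) (noether_actX j g2).
Qed.

End Metacyclic.

Theorem corollary4p3 (R : realType) (q alpha k m r : nat) (gT : finGroupType) :
  prime q -> odd q -> (0 < alpha)%N -> (2 <= k)%N -> ~~ (q %| alpha)%N ->
  m = (alpha * q ^ k)%N -> r = (alpha * q ^ k.-1 + 1)%N ->
  ([set: gT] \isog
     Grp (s1 : s2 : s1 ^+ m = s2 ^+ q = 1, s2^-1 * s1 * s2 = s1 ^+ r))%g ->
  purely_transcendental (ratfun_const R[i] gT) (@noether_field R[i] gT).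
Proof.
move=> q_pr _ alpha_gt0 k_gt1 _ -> ->; rewrite addn1.
have -> : (alpha * q ^ k = alpha * q ^ k.-1 * q)%N.
  by rewrite -mulnA -expnSr prednK // ltnW.
apply: metacyclic_purely_transcendental; first exact: pchar_num.
- exact: prime_gt1.
- by rewrite muln_gt0 alpha_gt0 expn_gt0 prime_gt0.
- by rewrite dvdn_mull // dvdn_exp // -subn1 subn_gt0.
Qed.
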